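(* Let $p$ be an odd prime and let $G$ be a non-abelian group of order $p^3$, so $G$ is one of $$\Phi_2(21) = \langle \alpha, \alpha_1, \alpha_2 : [\alpha_1, \alpha]=\alpha^p=\alpha_2,\ \alpha_1^p=\alpha_2^p=1 \rangle,\qquad \Phi_2(111) = \langle \alpha, \alpha_1, \alpha_2 : [\alpha_1, \alpha]=\alpha_2,\ \alpha^p=\alpha_1^p=\alpha_2^p=1 \rangle,$$ with $Z(G)=G'=\langle\alpha_2\rangle$. Then: (1) $|\mathrm{Irr}_{\mathbb{Q}}^{(1)}(G)|=1$, $|\mathrm{Irr}_{\mathbb{Q}}^{(\phi(p))}(G)|=p+1$, and $|\mathrm{Irr}_{\mathbb{Q}}^{(\phi(p^2))}(G)|=1$. (2) For $\mu\in\mathrm{Irr}(Z(G)\mid G')$, a special required pair $(H, \psi_\mu)$ to determine a rational matrix representation of $G$ whose character is $\Omega(\chi_\mu)$ is given by $H = \langle \alpha_1, \alpha_2 \rangle$ and the linear character $\psi_\mu$ of $H$ defined by $\psi_\mu(\alpha_1) = 1$ and $\psi_\mu(\alpha_2) = \mu(\alpha_2)$.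
   Context: In the presentations, all commutators of pairs of generators that are not listed are trivial; $[x,y]=x^{-1}y^{-1}xy$. $\phi$ is Euler's function. $\mathrm{Irr}_{\mathbb{Q}}^{(m)}(G)$ is the set of characters of degree $m$ of irreducible $\mathbb{Q}$-representations of $G$. $\mathrm{Irr}(Z(G)\mid G')=\{\mu\in\mathrm{Irr}(Z(G)) : G'\not\subseteq\ker\mu\}$; the non-linear irreducible complex characters of $G$ are exactly the $\chi_\mu$, $\mu\in\mathrm{Irr}(Z(G)\mid G')$, with $\chi_\mu(g)=p\mu(g)$ for $g\in Z(G)$ and $\chi_\mu(g)=0$ otherwise. $\Omega(\chi)=m_{\mathbb{Q}}(\chi)\sum_{\sigma\in\mathrm{Gal}(\mathbb{Q}(\chi)/\mathbb{Q})}\chi^\sigma$, with $m_{\mathbb{Q}}(\chi)$ the Schur index over $\mathbb{Q}$ (equal to $1$ for $p$-groups with $p$ odd). For $\chi\in\mathrm{Irr}(G)$ with $m_{\mathbb{Q}}(\chi)=1$, a special required pair for an irreducible rational matrix representation affording $\Omega(\chi)$ is a pair $(H,\psi)$ with $H\le G$, $\psi$ a linear character of $H$, $\psi^G=\chi$ (induced character) and $\mathbb{Q}(\psi)=\mathbb{Q}(\chi)$ (fields of character values). *)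

(* Defs.v *)
From HB Require Import structures.
From mathcomp Require Import all_boot all_order all_fingroup all_algebra.
From mathcomp Require Import all_solvable all_field all_character.

Set Implicit Arguments.
Unset Strict Implicit.
Unset Printing Implicit Defensive.

Import Order.TTheory GroupScope GRing.Theory Num.Theory.

Local Open Scope group_scope.
Local Open Scope ring_scope.

Section Groups.

Variables (p : nat) (gT : finGroupType) (G : {group gT}).

(* MathComp commutators are [~ x, y] = x^-1 * y^-1 * x * y.  In the two       *)
(* presentations, the commutators of a2 with a and a1 are the unlisted ones;  *)
(* they have to be spelled out as relations.  [\isog Grp] only provides some  *)
(* generating triple, so the triple at hand is required separately to         *)
(* generate G and to satisfy the relations; as G is finite, it then           *)
(* corresponds to the generators of the presented group under an isomorphism. *)
Definition Phi2_21 (a a1 a2 : gT) : Prop :=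
  [/\ (G \isog Grp (x : x1 : x2 :
         [~ x1, x] = x ^+ p, x ^+ p = x2, x1 ^+ p = 1, x2 ^+ p = 1,
         [~ x2, x] = 1, [~ x2, x1] = 1))%g,
      G :=: <<[set a; a1; a2]>>%g,
      [/\ [~ a1, a] = a ^+ p, a ^+ p = a2, a1 ^+ p = 1 & a2 ^+ p = 1]%g
    & [~ a2, a] = 1 /\ [~ a2, a1] = 1]%g.

Definition Phi2_111 (a a1 a2 : gT) : Prop :=
  [/\ (G \isog Grp (x : x1 : x2 :
         [~ x1, x] = x2, x ^+ p = 1, x1 ^+ p = 1, x2 ^+ p = 1,
         [~ x2, x] = 1, [~ x2, x1] = 1))%g,
      G :=: <<[set a; a1; a2]>>%g,
      [/\ [~ a1, a] = a2, a ^+ p = 1, a1 ^+ p = 1 & a2 ^+ p = 1]%g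
    & [~ a2, a] = 1 /\ [~ a2, a1] = 1]%g.

Fact chi_mu_subproof (mu : 'CF('Z(G))) :
  is_class_fun <<G>>
    [ffun g => if g \in 'Z(G)%g then p%:R * mu g else 0].
Proof.
rewrite genGid; apply: intro_class_fun => [x y Gx Gy | x].
  have nZy: y \in 'N('Z(G))%g by apply: subsetP Gy; apply: gFnorm.
  rewrite memJ_norm //; case: ifP => // Zx.
  by rewrite conjgE -(centerC Gy Zx) mulKg.
by apply: contraNeq; case: ifP => [/(subsetP (center_sub G))->|]; rewrite ?eqxx.
Qed.
Definition chi_mu (mu : 'CF('Z(G))) : 'CF(G) := Cfun 0 (chi_mu_subproof mu).

End Groups.

Section RationalCharacters.

Variables (gT : finGroupType) (G : {group gT}).

(* Characters take values in algC, where the values of all complex characters *)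
(* of a finite group lie.                                                     *)
Definition ratRepr_char n (rG : mx_representation rat G n) : 'CF(G) :=
  cfRepr (map_repr (ratr : {rmorphism rat -> algC}) rG).

Definition irrQ (m : nat) (phi : 'CF(G)) : Prop :=
  exists rG : mx_representation rat G m,
    mx_irreducible rG /\ phi = ratRepr_char rG.

(* Multiplicity of chi in the irreducible rational representation of which it *)
(* is a constituent (all such representations are isomorphic over rat).       *)
Definition schur_index (chi : 'CF(G)) (m : nat) : Prop :=
  exists n (rG : mx_representation rat G n),
    [/\ mx_irreducible rG, (0 < m)%N & '[ratRepr_char rG, chi] = m%:R].

(* z \in Q(phi): Q(phi) is the intersection of all subfields of algC which    *)
(* contain the values of phi.                                                 *)
Definition in_char_field (phi : 'CF(G)) (z : algC) : Prop :=
  forall F : divringClosed algC, {in G, forall g, phi g \in F} -> z \in F.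

(* theta = m_Q(chi) \sum_(s in Gal(Q(chi) / Q)) chi ^ s, where L is a copy of *)
(* Q(chi), identified with it through iota; Q(chi) is Galois over Q because   *)
(* it is contained in a cyclotomic field.                                     *)
Definition is_Omega (chi theta : 'CF(G)) : Prop :=
  exists m (L : splittingFieldType rat) (iota : {rmorphism L -> algC}),
  [/\ schur_index chi m,
      forall z, in_char_field chi z <-> exists x, iota x = z
    & forall g x, iota x = chi g ->
        theta g = m%:R * \sum_(s in 'Gal({:L} / 1)) iota (s x)].

End RationalCharacters.

Definition special_required_pair (gT : finGroupType) (G : {group gT})
    (chi : 'CF(G)) (H : {group gT}) (psi : 'CF(H)) : Prop :=
  [/\ chi \in irr G /\ schur_index chi 1,
      H \subset G,
      psi \is a linear_char,
      'Ind[G] psi = chi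
    & forall z, in_char_field psi z <-> in_char_field chi z].

Definition has_card (T : eqType) (P : T -> Prop) (k : nat) : Prop :=
  exists s : seq T, [/\ uniq s, size s = k & forall x, P x <-> x \in s].

(* Main.v *)
Require Import Defs.
From HB Require Import structures.
From mathcomp Require Import all_boot all_order all_fingroup all_algebra.
From mathcomp Require Import all_solvable all_field all_character.
From Stdlib Require Import Classical.

Set Implicit Arguments.
Unset Strict Implicit.
Unset Printing Implicit Defensive.

Import Order.TTheory GroupScope GRing.Theory Num.Theory.

Local Open Scope ring_scope.

(** The proof compares two descriptions of the characters of G.

Complex side. G is extraspecial, so Z(G) = G' has order p and G has p^2 linear
characters. A non-linear irreducible character chi is squeezed by
p^2 <= chi(1)^2 <= |G : Z(chi)| <= |G : Z(G)| = p^2, and the resulting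
equalities make chi vanish off Z(G) and equal to some chi_mu
([nonlinear_irrE]). The sum of the squares of the degrees leaves p - 1 of
them, and they are all Galois conjugate, because they correspond to the
faithful characters of a group of order p ([nonlinear_conj]).

Rational side. By Schur's lemma, irreducible rational characters that share a
complex constituent are equal ([irrQ_eq]), and every complex irreducible
character occurs in one of them ([ex_irrQ_constt]). Hence the irreducible
rational characters cut Irr(G) into blocks. A block is stable under Galois
conjugation, with constant multiplicities on conjugate characters, which
bounds degrees from below. The upper bound is [irrQ_degree_bound]: a
non-trivial irreducible rational representation with a non-zero vector fixed
by H is spanned by the |G : H| images of that vector, whose sum is fixed by G
and so vanishes; the degree is therefore less than |G : H|. With H the kernel
of a non-trivial linear character, of index p, the block consists of p - 1
characters and the degree is p - 1. With H a non-central subgroup of order p,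
of index p^2, the block of a non-linear character consists of all the p - 1
non-linear ones, with multiplicity 1. So the Schur index of chi_mu is 1, and
the numbers of rational characters follow: the p^2 - 1 non-trivial linear
characters fall into p + 1 blocks of size p - 1.

Special pair and Omega. The group generated by a1 and a2 is <a1> x Z(G), and
psi_mu is the product of the trivial character of <a1> with mu. The induced
character contains chi_mu by Frobenius reciprocity and has the same degree p,
hence is chi_mu. All values involved are 0 or rational multiples of powers of
mu(a2), so both character fields are Q(mu(a2)). The Galois group of this field
is in bijection with the non-linear characters, through its action on
mu(a2), which identifies Omega(chi_mu) with the sum of the non-linear
characters.

Presentations. If G has exponent p it is isomorphic to p^{1+2}; otherwise it
has a cyclic subgroup of index p and is isomorphic to the modular group of
order p^3. Both have well-known presentations with two generators x and y;
those considered here arise from them by naming the commutator of the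
generators, and, in the modular case, by replacing y with its inverse. *)

(** * Schur orthogonality over an arbitrary field *)

Section Intertwiners.

Variables (F : fieldType) (gT : finGroupType) (G : {group gT}).
Variables (n1 n2 : nat).
Variables (rG1 : mx_representation F G n1) (rG2 : mx_representation F G n2).

(** Schur's lemma: the kernel of X is a proper submodule of the first
representation, hence zero, and its image is a non-zero submodule of the
second one, hence everything. *)
Lemma intertwiner_rsim (X : 'M_(n1, n2)) :
    mx_irreducible rG1 -> mx_irreducible rG2 ->
    {in G, forall g, rG1 g *m X = X *m rG2 g} -> X != 0 ->
  mx_rsim rG1 rG2.
Proof.
move=> /mx_irrP[_ irr1] /mx_irrP[_ irr2] cX nzX.
have freeX: row_free X.
  rewrite -kermx_eq0; apply: contraNT nzX => nzK.
  have modK: mxmodule rG1 (kermx X).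
    apply/mxmoduleP=> g Gg; apply/sub_kermxP.
    by rewrite -mulmxA cX // mulmxA mulmx_ker mul0mx.
  have /row_fullP[B BK] := irr1 _ modK nzK.
  by rewrite -[X]mul1mx -BK -mulmxA mulmx_ker mulmx0.
have fullX: row_full X.
  have modX: mxmodule rG2 <<X>>%MS.
    apply/mxmoduleP=> g Gg; rewrite (eqmxMr _ (genmxE X)) genmxE -cX //.
    exact: submxMl.
  have := irr2 _ modX; rewrite /row_full !genmxE; apply.
  by rewrite -mxrank_eq0 genmxE mxrank_eq0.
have e12: n1 = n2 by rewrite -(eqP freeX) (eqP fullX).
exact: MxReprSim e12 freeX cX.
Qed.

(** Averaging the matrix unit E_ij over G yields an intertwiner X_ij, and the
sum in the hypothesis is the sum over all i and j of the (i, j) entry of X_ij;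
some X_ij is therefore non-zero, and Schur's lemma applies to it. *)
Lemma rsim_of_mxtrace_neq0 :
    mx_irreducible rG1 -> mx_irreducible rG2 ->
    \sum_(g in G) \tr (rG1 g) * \tr (rG2 g^-1%g) != 0 ->
  mx_rsim rG1 rG2.
Proof.
move=> irr1 irr2 nz.
pose X i j := \sum_(g in G) rG1 g *m delta_mx i j *m rG2 g^-1%g.
have cX i j : {in G, forall h, rG1 h *m X i j = X i j *m rG2 h}.
  move=> h Gh; rewrite mulmx_sumr mulmx_suml [RHS](reindex_inj (mulgI h)) /=.
  apply: eq_big => [g | g Gg]; first by rewrite groupMl.
  rewrite -!mulmxA -repr_mxM ?groupV ?groupM // !mulmxA -repr_mxM //.
  by rewrite invMg mulgKV.
case: (boolP [forall i, forall j, X i j == 0]) => [/forallP X0 | ].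
  case/eqP: nz.
  transitivity (\sum_i \sum_j X i j i j).
    rewrite /X; under [RHS]eq_bigr do under eq_bigr do rewrite summxE.
    under [RHS]eq_bigr do rewrite exchange_big; rewrite exchange_big /=.
    apply: eq_bigr => g Gg; rewrite /mxtrace big_distrl /=; apply: eq_bigr => i _.
    rewrite big_distrr /=; apply: eq_bigr => j _.
    rewrite !mxE (bigD1 j) //= !mxE (bigD1 i) //= !mxE !eqxx mulr1.
    rewrite big1 ?addr0 => [|k /negPf nki]; last by rewrite !mxE nki mulr0.
    rewrite big1 ?addr0 // => k /negPf nkj; rewrite !mxE big1 ?mul0r // => l _.
    by rewrite !mxE nkj andbF mulr0.
  rewrite big1 // => i _; rewrite big1 // => j _.
  by have /forallP/(_ j)/eqP-> := X0 i; rewrite mxE.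
move/forallPn=> [i /forallPn[j nzX]].
exact: intertwiner_rsim irr1 irr2 (cX i j) nzX.
Qed.

End Intertwiners.

(** * Irreducible rational characters *)

Section RationalCharacters.

Variables (gT : finGroupType) (G : {group gT}).
Implicit Types (phi : 'CF(G)) (chi : 'CF(G)).

Lemma ratRepr_charE n (rG : mx_representation rat G n) g :
  g \in G -> ratRepr_char rG g = ratr (\tr (rG g)).
Proof. by move=> Gg; rewrite cfunE Gg /map_repr /= trace_map_mx. Qed.

Lemma ratRepr_char_char n (rG : mx_representation rat G n) :
  ratRepr_char rG \is a character.
Proof. exact: cfRepr_char. Qed.

Lemma cfAut_ratRepr_char u n (rG : mx_representation rat G n) :
  cfAut u (ratRepr_char rG) = ratRepr_char rG.
Proof. by apply/cfun_inP=> g Gg; rewrite cfunE /= ratRepr_charE // fmorph_rat. Qed.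

Lemma ratRepr_char_rsim n1 n2 (rG1 : mx_representation rat G n1)
    (rG2 : mx_representation rat G n2) :
  mx_rsim rG1 rG2 -> ratRepr_char rG1 = ratRepr_char rG2.
Proof.
by move=> sim; apply/cfun_inP=> g Gg; rewrite !ratRepr_charE // (mxtrace_rsim sim).
Qed.

Lemma irrQ_char m phi : irrQ m phi -> phi \is a character.
Proof. by case=> rG [_ ->]; apply: ratRepr_char_char. Qed.

Lemma irrQ1 m phi : irrQ m phi -> phi 1%g = m%:R.
Proof. by case=> rG [_ ->]; rewrite cfRepr1. Qed.

Lemma cfAut_irrQ u m phi : irrQ m phi -> cfAut u phi = phi.
Proof. by case=> rG [_ ->]; apply: cfAut_ratRepr_char. Qed.

(** Schur orthogonality is used over the rationals, where the averaging takes
place; the embedding of the rationals only transports the resulting number to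
the inner product of complex class functions. *)
Lemma irrQ_eq m1 m2 phi1 phi2 :
  irrQ m1 phi1 -> irrQ m2 phi2 -> '[phi1, phi2] != 0 -> phi1 = phi2.
Proof.
case=> rG1 [irr1 ->] [rG2 [irr2 ->]] nz; apply: ratRepr_char_rsim.
apply: rsim_of_mxtrace_neq0 => //; apply: contraNneq nz => eq0.
rewrite cfdotE mulf_eq0; apply/orP; right.
apply/eqP; transitivity (ratr (\sum_(g in G) \tr (rG1 g) * \tr (rG2 g^-1%g)) : algC).
  rewrite rmorph_sum; apply: eq_bigr => g Gg /=.
  by rewrite -char_inv ?ratRepr_char_char // rmorphM !ratRepr_charE ?groupV.
by rewrite eq0 rmorph0.
Qed.

(** If the representation is not irreducible, its character is the sum of those
of a proper submodule and of the quotient, so the constituent can be followed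
down to an irreducible section. Irreducibility is stated as a proposition,
hence the appeal to excluded middle. *)
Lemma irrQ_constituent n (rG : mx_representation rat G n) i :
  i \in irr_constt (ratRepr_char rG) ->
  exists m phi, irrQ m phi /\ i \in irr_constt phi.
Proof.
have [k] := ubnP n; elim: k n rG => // k IHk n rG /ltnSE-le_nk rGi.
have [irrG | nirrG] := classic (mx_irreducible rG).
  by exists n, (ratRepr_char rG); split=> //; exists rG.
have n_gt0: (0 < n)%N.
  rewrite lt0n; apply: contraTneq rGi => n0; rewrite irr_consttE negbK.
  suffices ->: ratRepr_char rG = 0 by rewrite cfdot0l.
  by apply/eqP; rewrite -(char1_eq0 (ratRepr_char_char rG)) cfRepr1 n0.
have [U [modU nzU ltUn]]: exists U : 'M_n, [/\ mxmodule rG U, U != 0 & (\rank U < n)%N].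
  apply: NNPP => noU; case: nirrG; apply/mx_irrP; split=> // U modU nzU.
  apply: contraT => nfU; case: noU; exists U; split=> //.
  by rewrite ltn_neqAle nfU rank_leq_row.
have defphi: ratRepr_char rG = ratRepr_char (submod_repr modU)
                               + ratRepr_char (factmod_repr modU).
  apply/cfun_inP=> g Gg; rewrite [RHS]cfunE !ratRepr_charE // -rmorphD /=.
  by rewrite mxtrace_sub_fact_mod.
rewrite defphi irr_consttE cfdotDl in rGi.
have [nz | z] := boolP (i \in irr_constt (ratRepr_char (submod_repr modU))).
  by apply: IHk nz; apply: leq_trans ltUn le_nk.
apply: (IHk _ (factmod_repr modU)).
  rewrite mxrank_coker (leq_trans _ le_nk) // ltn_subrL lt0n mxrank_eq0 nzU n_gt0 //.
by move: rGi z; rewrite !irr_consttE negbK => rGi /eqP z; rewrite z add0r in rGi.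
Qed.

Lemma ex_irrQ_constt i : exists m phi, irrQ m phi /\ i \in irr_constt phi.
Proof.
apply: (irrQ_constituent (rG := regular_repr rat G)).
suffices ->: ratRepr_char (regular_repr rat G) = cfReg G.
  rewrite irr_consttE cfReg_sum cfdot_suml (bigD1 i) //= big1 ?addr0.
    by rewrite cfdotZl cfdot_irr eqxx mulr1 irr1_neq0.
  by move=> j /negPf ne_ji; rewrite cfdotZl cfdot_irr ne_ji mulr0.
rewrite -cfReprReg; apply/cfun_inP=> g Gg; rewrite !cfunE Gg.
by congr (\tr _); apply: map_regular_mx.
Qed.

(** The fibres of theta are the blocks of Irr(G) cut out by the irreducible
rational characters. *)
Lemma irrQ_family : exists deg : Iirr G -> nat, exists theta : Iirr G -> 'CF(G),
  [/\ forall i, irrQ (deg i) (theta i),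
      forall i, i \in irr_constt (theta i)
    & forall m phi i, irrQ m phi -> i \in irr_constt phi ->
        phi = theta i /\ m = deg i].
Proof.
have [f Pf] := fin_all_exists ex_irrQ_constt.
have [theta Ptheta] := fin_all_exists Pf.
exists f, theta; split=> [i | i | m phi i irr_phi phi_i]; try by case: (Ptheta i).
have [irr_i theta_i] := Ptheta i.
have eq_phi: phi = theta i.
  apply: (irrQ_eq irr_phi irr_i).
  apply/eqP=> /(constt_ortho_char (irrQ_char irr_phi) (irrQ_char irr_i) phi_i theta_i).
  by apply/eqP; rewrite cfnorm_irr oner_eq0.
split=> //; apply/eqP; rewrite -(eqr_nat algC) -(irrQ1 irr_phi) -(irrQ1 irr_i).
by rewrite eq_phi.
Qed.

Lemma irrQ_cfun1 : irrQ 1 (1 : 'CF(G)).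
Proof.
have trivP: mx_repr G (fun _ : gT => 1%:M : 'M[rat]_1).
  by split=> [//|x y _ _]; rewrite mulmx1.
exists (MxRepresentation trivP); split.
  by apply: mx_abs_irrW; apply: linear_mx_abs_irr.
by apply/cfun_inP=> g Gg; rewrite ratRepr_charE //= mxtrace1 cfun1E Gg rmorph_nat.
Qed.

End RationalCharacters.

(** * A degree bound from fixed vectors *)

(** As v is fixed by H, v *m rG g depends only on the right coset of g, so at
most |G : H| vectors occur in the orbit of v. They span a submodule, which is
the whole space by irreducibility; and they are linearly dependent, since
their sum, multiplied by |H|, is the sum over G. *)
Lemma orbit_span_bound (F : fieldType) (gT : finGroupType) (G H : {group gT}) n
    (rG : mx_representation F G n) (v : 'rV_n) :
    mx_irreducible rG -> H \subset G -> #|H|%:R != 0 :> F -> v != 0 ->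
    {in H, forall h, v *m rG h = v} -> \sum_(g in G) v *m rG g = 0 ->
  (n < #|G : H|)%N.
Proof.
move=> /mx_irrP[_ irrG] sHG nzH nzv vH sum0.
have rcG C : C \in rcosets H G -> repr C \in G /\ C = H :* repr C.
  case/rcosetsP=> x Gx ->; case: repr_rcosetP => h Hh.
  split; [by rewrite groupM // (subsetP sHG) | by rewrite rcosetM (rcoset_id Hh)].
have vC C x : C \in rcosets H G -> x \in C -> v *m rG x = v *m rG (repr C).
  move=> rcC; have [Gr {1}->] := rcG C rcC; case/rcosetP=> h Hh ->.
  have Gh := subsetP sHG h Hh.
  by rewrite repr_mxM // mulmxA vH.
pose M := \matrix_(k < #|rcosets H G|) (v *m rG (repr (enum_val k))).
have rowM C : C \in rcosets H G -> (v *m rG (repr C) <= M)%MS.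
  move=> rcC; rewrite -(enum_rankK_in rcC rcC).
  by apply: eq_row_sub (enum_rank_in rcC C) _; rewrite rowK.
have modM: mxmodule rG <<M>>%MS.
  apply/mxmoduleP=> x Gx; rewrite (eqmxMr _ (genmxE M)) genmxE.
  apply/row_subP=> k; rewrite row_mul rowK -mulmxA.
  have [Gr defC] := rcG _ (enum_valP k); rewrite -repr_mxM //.
  have rcCx: (H :* (repr (enum_val k) * x))%g \in rcosets H G.
    by apply/rcosetsP; exists (repr (enum_val k) * x)%g; rewrite ?groupM.
  by rewrite (vC _ _ rcCx) ?rcoset_refl // rowM.
have fullM: \rank M = n.
  have := irrG _ modM; rewrite /row_full !genmxE => /(_ _)/eqP-> //.
  rewrite -mxrank_eq0 genmxE mxrank_eq0; apply: contraNneq nzv => M0.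
  have rcH: H :* 1 \in rcosets H G by apply/rcosetsP; exists 1%g.
  have:= rowM _ rcH; rewrite -(vC _ 1%g rcH) ?rcoset_refl // repr_mx1 mulmx1 M0.
  by move/submx0null->.
rewrite -fullM ltn_neqAle rank_leq_row andbT; apply: contra nzH => freeM.
have: #|H|%:R *: (const_mx 1 *m M) = 0 :> 'rV_n.
  rewrite -sum0 (set_partition_big _ (rcosets_partition sHG)) /=.
  rewrite (eq_bigr (fun C => #|H|%:R *: (v *m rG (repr C)))) => [|C rcC].
    rewrite -scaler_sumr big_enum_val; congr (_ *: _).
    rewrite mulmx_sum_row; apply: eq_bigr => k _.
    by rewrite mxE scale1r rowK.
  rewrite (eq_bigr (fun _ => v *m rG (repr C))) => [|x Cx]; last exact: vC.
  rewrite sumr_const scaler_nat; congr (_ *+ _).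
  by have [_ ->] := rcG _ rcC; rewrite card_rcoset.
move/eqP; rewrite scaler_eq0 => /orP[// |]; rewrite mulmx_free_eq0 //.
have k0: 'I_#|rcosets H G|.
  by rewrite -[#|_|]/#|G : H|%g; exists 0%N; apply: indexg_gt0.
by move/eqP/matrixP/(_ 0 k0); rewrite !mxE => /eqP; rewrite oner_eq0.
Qed.

(** The trace of the sum of rG over a subgroup is, up to its order, the
multiplicity of the trivial character in the restriction. So the sum N over H
is non-zero, and any non-zero row of N is a vector fixed by H. The sum over G
commutes with G; it vanishes by Schur's lemma, as its invertibility would make
G act trivially. *)
Lemma irrQ_degree_bound (gT : finGroupType) (G H : {group gT}) m (phi : 'CF(G)) :
    irrQ m phi -> H \subset G -> '['Res[H] phi, 1] != 0 -> '[phi, 1] = 0 ->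
  (m < #|G : H|)%N.
Proof.
case=> rG [irrG ->] sHG nzH phi0.
have nat_neq0 (K : {group gT}) : #|K|%:R != 0 :> rat by rewrite pnatr_eq0 -lt0n cardG_gt0.
pose N (K : {group gT}) := \sum_(g in K) rG g.
have NE (K : {group gT}) g : K \subset G -> g \in K -> N K *m rG g = N K.
  move=> sKG Kg; rewrite mulmx_suml [RHS](reindex_inj (mulIg g)) /=.
  apply: eq_big => [h | h Kh]; first by rewrite groupMr.
  by rewrite repr_mxM ?(subsetP sKG).
have trN (K : {group gT}) : K \subset G ->
  ratr (\tr (N K)) = #|K|%:R * '['Res[K] (ratRepr_char rG), 1] :> algC.
- move=> sKG; rewrite cfdotE mulVKf ?neq0CG //.
  rewrite (raddf_sum (@mxtrace rat m) _ _ (fun g => rG g)) rmorph_sum /=.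
  apply: eq_bigr => g Kg; rewrite cfun1E Kg conjC1 mulr1 cfResE //.
  by rewrite ratRepr_charE // (subsetP sKG).
have NG0: N G = 0.
  apply: contraTeq (nat_neq0 G) => nzN; rewrite negbK.
  have cN: centgmx rG (N G).
    apply/centgmxP=> g Gg; rewrite NE // mulmx_sumr [LHS](reindex_inj (mulgI g)) /=.
    by apply: eq_big => [h | h Kh]; rewrite ?groupMl // ?repr_mxM // -(groupMl _ Gg).
  have unitN := mx_Schur irrG cN nzN.
  have rG1 g : g \in G -> rG g = 1%:M.
    by move=> Gg; rewrite -(mulKmx unitN (rG g)) NE // mulVmx.
  have := trN G (subxx _); rewrite cfRes_id phi0 mulr0.
  rewrite /N (eq_bigr _ rG1) sumr_const -scaler_nat mxtraceZ mxtrace1.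
  move/eqP; rewrite fmorph_eq0 mulf_eq0 => /orP[|] //.
  by have [n_gt0 _] := (mx_irrP rG).1 irrG; rewrite pnatr_eq0 -leqn0 leqNgt n_gt0.
have nzNH: N H != 0.
  apply: contraNneq nzH => N0; have := trN H sHG; rewrite N0 mxtrace0 rmorph0.
  by move/esym/eqP; rewrite mulf_eq0 (negPf (neq0CG H)).
have [i nzv] : exists i, row i (N H) != 0.
  apply/existsP; apply: contraR nzNH => /existsPn N0; apply/eqP/row_matrixP=> i.
  by rewrite row0; apply/eqP; rewrite -[_ == _]negbK N0.
apply: (orbit_span_bound irrG sHG (nat_neq0 H) nzv) => [h Hh|].
  by rewrite -row_mul NE.
by rewrite -mulmx_sumr -/(N G) NG0 mulmx0.
Qed.

(** * Complex characters of a non-abelian group of order p^3 *)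

Lemma prime_unity_root_prim (F : fieldType) p (z : F) :
  prime p -> z ^+ p = 1 -> z != 1 -> p.-primitive_root z.
Proof.
move=> p_prime zp1 nz1; have [d prim_d] := prim_order_exists (prime_gt0 p_prime) zp1.
case/primeP: p_prime => _ /[apply]/orP[/eqP d1 | /eqP <- //].
by case/eqP: nz1; rewrite -(prim_expr_order prim_d) d1.
Qed.

Section ExtraspecialCube.

Variables (p : nat) (gT : finGroupType) (G : {group gT}).
Hypotheses (p_prime : prime p) (cardG : #|G| = (p ^ 3)%N).
Hypothesis (nabG : ~~ abelian G).

Let p_gt0 := prime_gt0 p_prime.
Let p_gt1 := prime_gt1 p_prime.

Lemma pgroup_cube : p.-group G. Proof. by rewrite /pgroup cardG pnatX pnat_id. Qed.

Lemma extraspecial_cube : extraspecial G.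
Proof. by apply: (p3group_extraspecial pgroup_cube); rewrite ?cardG ?pfactorK. Qed.

Lemma der1_cube : G^`(1)%g = 'Z(G)%g. Proof. by have [[]] := extraspecial_cube. Qed.

Lemma card_center_cube : #|'Z(G)%g| = p.
Proof. exact: card_center_extraspecial pgroup_cube extraspecial_cube. Qed.

Lemma index_center_cube : #|G : 'Z(G)%g| = (p ^ 2)%N.
Proof. by rewrite -divgS ?center_sub // cardG card_center_cube expnSr mulnK. Qed.

Lemma expg_cube_center g : g \in G -> (g ^+ p)%g \in 'Z(G)%g.
Proof.
have [[defPhi _] _] := extraspecial_cube => Gg; have pG := pgroup_cube.
by rewrite -defPhi (Phi_joing pG) mem_gen // inE orbC (Mho_p_elt 1) // (mem_p_elt pG).
Qed.

Lemma lin_char_cubeX (xi : 'CF(G)) g :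
  xi \is a linear_char -> g \in G -> xi g ^+ p = 1.
Proof.
move=> Lxi Gg; rewrite -lin_charX // cfker1 ?lin_char1 //.
by apply: subsetP (expg_cube_center Gg); rewrite -der1_cube lin_char_der1.
Qed.

Lemma chi_muE (mu : 'CF('Z(G))) g :
  chi_mu p mu g = if g \in 'Z(G)%g then p%:R * mu g else 0.
Proof. by rewrite cfunE. Qed.

Lemma nonlinear_center_inj (mu : 'CF('Z(G))) :
    mu \in irr 'Z(G) -> ~~ (G^`(1)%g \subset cfker mu) ->
  mu \is a linear_char /\ {in 'Z(G)%g &, injective mu}.
Proof.
have prZ: prime #|'Z(G)%G| by rewrite card_center_cube.
case/irrP=> i -> nK; split; first exact: irr_prime_lin.
apply: (elimT (irr_prime_injP prZ)); apply: contraNneq nK => ->.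
by rewrite der1_cube irr0 cfker_cfun1.
Qed.

(** The degree d divides p^3 and is not 1, so p^2 <= d^2 <= |G : Z(chi)|, while
|G : Z(chi)| is at most |G : Z(G)| = p^2. Equality in the bound on d^2 says
that chi vanishes off Z(chi), and equality of the indices that Z(chi) = Z(G),
where chi is d = p times a linear character. *)
Lemma nonlinear_irrE i : ~~ ('chi[G]_i \is a linear_char) ->
  exists mu, [/\ mu \in irr 'Z(G), ~~ (G^`(1)%g \subset cfker mu),
                 'chi_i = chi_mu p mu & 'Res['Z(G)] 'chi_i = p%:R *: mu].
Proof.
move=> nlin; set chi := 'chi_i.
have sZZ: 'Z(G) \subset 'Z(chi)%CF by rewrite -cap_cfcenter_irr bigcap_inf.
have /natrP[d chi1]: chi 1%g \in Num.nat by rewrite Cnat_irr1.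
have d_neq1: d != 1%N.
  by apply: contraNneq nlin => d1; rewrite qualifE/= irr_char chi1 d1 /=.
have dv: (d %| p ^ 3)%N.
  by have := dvd_irr1_cardG i; rewrite -/chi cardG chi1 dvdC_nat.
have le_pd: (p <= d)%N.
  have [m _ Dm] := dvdn_pfactor _ _ p_prime dv.
  case: m Dm => [|m] Dm; first by rewrite Dm in d_neq1.
  by rewrite Dm expnS leq_pmulr ?expn_gt0 ?p_gt0.
have iZ : (#|G : 'Z(chi)%CF| * #|'Z(chi)%CF : 'Z(G)| = p ^ 2)%N.
  by rewrite Lagrange_index ?cfcenter_sub // index_center_cube.
have [] := irr1_bound i; rewrite -/chi chi1 -natrX ler_nat eqr_nat => le_d iff_d.
have le_i: (#|G : 'Z(chi)%CF| <= p ^ 2)%N by rewrite -iZ leq_pmulr ?indexg_gt0.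
have le_p2: (p ^ 2 <= d ^ 2)%N by rewrite leq_exp2r.
have Dd: d = p.
  by apply/eqP; rewrite -(@eqn_exp2r _ _ 2) // eqn_leq le_p2 (leq_trans le_d).
rewrite Dd in chi1 le_d iff_d.
have Di: #|G : 'Z(chi)%CF| = (p ^ 2)%N by apply/eqP; rewrite eqn_leq le_i.
have{iff_d} /cfun_onP chi0: chi \in 'CF(G, 'Z(chi)%CF) by rewrite -iff_d Di.
have DZ: 'Z(chi)%CF = 'Z(G) :> {set gT}.
  apply/esym/eqP; rewrite eqEcard sZZ -(Lagrange sZZ) /= .
  move/eqP: iZ; rewrite Di -{2}[(p ^ 2)%N]muln1 eqn_pmul2l ?expn_gt0 ?p_gt0 //.
  by move/eqP=> ->; rewrite muln1.
have [lam Llam Dlam] := cfcenter_Res chi; rewrite chi1 in Dlam.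
pose mu := 'Res['Z(G)] lam.
have Dmu: 'Res['Z(G)] chi = p%:R *: mu.
  by rewrite -(cfResRes _ sZZ (cfcenter_sub _)) Dlam linearZ.
have Lmu: mu \is a linear_char by rewrite cfRes_lin_char.
have defchi: chi = chi_mu p mu.
  apply/cfunP=> g; rewrite chi_muE; case: ifP => [Zg | /negbT nZg].
    by rewrite -[chi g](cfResE _ (center_sub G) Zg) Dmu cfunE.
  by rewrite chi0 // DZ.
exists mu; split=> //; first exact: lin_char_irr.
apply: contra nlin => sGK; rewrite lin_irr_der1; apply/subsetP=> z G'z.
have Zz: z \in 'Z(G) by rewrite -der1_cube.
rewrite cfkerEirr inE -/chi defchi !chi_muE Zz group1.
by rewrite (cfker1 (subsetP sGK _ G'z)).
Qed.

(** Every constituent of the character induced from mu lies over mu, so it is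
non-linear, and it is chi_nu for some nu; restricting to the centre shows that
nu = mu. *)
Lemma chi_mu_irr (mu : 'CF('Z(G))) :
  mu \in irr 'Z(G) -> ~~ (G^`(1)%g \subset cfker mu) ->
  chi_mu p mu \in irr G.
Proof.
move=> irr_mu nK; have [Lmu _] := nonlinear_center_inj irr_mu nK.
have [k Dk] := irrP irr_mu.
have [i] := constt_cfInd_irr k (center_sub G).
rewrite irr_consttE -Frobenius_reciprocity -Dk => nz.
have nlin: ~~ ('chi_i \is a linear_char).
  apply: contra nK => Li; rewrite der1_cube.
  have := lin_char_irr (cfRes_lin_char 'Z(G) Li) => /irrP[l Dl].
  move: nz; rewrite Dl Dk cfdot_irr; case: (eqVneq k l) => [Dkl _|_]; last by rewrite eqxx.
  rewrite Dkl -Dl; apply/subsetP=> z Zz; rewrite cfkerEchar ?cfRes_char ?irr_char //.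
  rewrite inE Zz /= !cfResE ?center_sub // cfker1 //.
  by apply: (subsetP (lin_char_der1 Li)); rewrite der1_cube.
have [nu [irr_nu _ Di Dnu]] := nonlinear_irrE nlin.
suffices ->: mu = nu by rewrite -Di mem_irr.
move: nz; rewrite Dnu; have [l Dl] := irrP irr_nu; rewrite Dl Dk cfdotZr cfdot_irr.
by case: (eqVneq k l) => [-> // | _]; rewrite mulr0 eqxx.
Qed.

Lemma nonlinear_degree i : ~~ ('chi[G]_i \is a linear_char) -> 'chi_i 1%g = p%:R.
Proof.
case/nonlinear_irrE=> mu [irr_mu nK -> _]; rewrite chi_muE group1.
by have [Lmu _] := nonlinear_center_inj irr_mu nK; rewrite lin_char1 ?mulr1.
Qed.

Lemma chi_mu_nonlinear (mu : 'CF('Z(G))) :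
  mu \in irr 'Z(G) -> ~~ (G^`(1)%g \subset cfker mu) ->
  exists2 i, ~~ ('chi[G]_i \is a linear_char) & chi_mu p mu = 'chi_i.
Proof.
move=> irr_mu nK; have /irrP[i Di] := chi_mu_irr irr_mu nK; exists i => //.
have [Lmu _] := nonlinear_center_inj irr_mu nK.
apply/negP=> /lin_char1; rewrite -Di chi_muE group1 lin_char1 // mulr1.
by apply/eqP; rewrite pnatr_eq1 gtn_eqF.
Qed.

(** The squares of the degrees add up to p^3, of which the p^2 linear
characters account for p^2. *)
Lemma card_nonlinear : #|[pred i | ~~ ('chi[G]_i \is a linear_char)]| = p.-1.
Proof.
apply/eqP; rewrite -(eqn_pmul2r (_ : 0 < p ^ 2)%N) ?expn_gt0 ?p_gt0 //.
rewrite -(eqn_add2r (p ^ 2)).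
have ->: (p.-1 * p ^ 2 + p ^ 2 = #|G|)%N by rewrite -mulSnr prednK // -expnS cardG.
have ->: (p ^ 2 = #|[pred i | 'chi[G]_i \is a linear_char]|)%N.
  by rewrite card_lin_irr der1_cube index_center_cube.
rewrite -(eqr_nat algC) /=.
rewrite -irr_sum_square (bigID (fun i => 'chi_i \is a linear_char)) /= addrC natrD.
rewrite (eq_bigr (fun _ => #|[pred i | 'chi[G]_i \is a linear_char]|%:R)); last first.
  by move=> i /nonlinear_degree->; rewrite card_lin_irr der1_cube index_center_cube natrX.
rewrite [in X in _ == _ + X](eq_bigr (fun _ => 1)) => [|i /lin_char1->]; last by rewrite expr1n.
by rewrite !sumr_const natrM mulr_natl eqxx.
Qed.

(** At a generator z of the centre, the central characters mu and nu take
primitive p-th roots of unity as values, and an automorphism of the algebraic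
numbers carries one to the other. *)
Lemma nonlinear_conj i j :
    ~~ ('chi[G]_i \is a linear_char) -> ~~ ('chi[G]_j \is a linear_char) ->
  exists u : {rmorphism algC -> algC}, 'chi_j = cfAut u 'chi_i.
Proof.
case/nonlinear_irrE=> mu [irr_mu nKmu -> _] /nonlinear_irrE[nu [irr_nu nKnu -> _]].
have [Lmu inj_mu] := nonlinear_center_inj irr_mu nKmu.
have [Lnu inj_nu] := nonlinear_center_inj irr_nu nKnu.
have prZ: prime #|'Z(G)%G| by rewrite card_center_cube.
have /cyclicP[z defZ] := prime_cyclic prZ; rewrite /= in defZ.
have Zz: z \in 'Z(G) by rewrite defZ cycle_id.
have oz: #[z] = p by rewrite orderE -defZ card_center_cube.
have prim (xi : 'CF('Z(G))) : xi \is a linear_char -> {in 'Z(G)%g &, injective xi} ->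
  p.-primitive_root (xi z).
- move=> Lxi inj_xi; apply: prime_unity_root_prim => //.
    by rewrite -oz lin_char_unity_root.
  rewrite -(lin_char1 Lxi) (inj_in_eq inj_xi) ?group1 //.
  by rewrite -order_gt1 oz.
have [k Dk] := prim_rootP (prim mu Lmu inj_mu) (prim_expr_order (prim nu Lnu inj_nu)).
have co_k: coprime k p.
  by rewrite -(prim_root_exp_coprime _ (prim mu Lmu inj_mu)) -Dk prim.
have [u Du] := Qn_aut_exists co_k; exists u; apply/cfunP=> g.
have ->: cfAut u (chi_mu p mu) g = u (chi_mu p mu g) by rewrite [LHS]cfunE.
rewrite !chi_muE; case: ifP => [Zg|_]; last by rewrite rmorph0.
have /cycleP[m ->]: g \in <[z]>%g by rewrite -defZ.
rewrite rmorphM rmorph_nat !lin_charX // rmorphXn /=.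
by rewrite Du -?Dk // -lin_charX // -oz expg_order lin_char1.
Qed.

End ExtraspecialCube.

(** * Constituents of irreducible rational characters *)

Section RationalConstituents.

Variables (gT : finGroupType) (G : {group gT}).

Lemma cfdot_irrQ_aut u m phi i :
  irrQ m phi -> '[phi, 'chi[G]_(aut_Iirr u i)] = '[phi, 'chi_i].
Proof.
move=> Qphi; rewrite aut_IirrE -{1}(cfAut_irrQ u Qphi) cfdot_aut_irr.
by rewrite aut_natr // Cnat_cfdot_char_irr // (irrQ_char Qphi).
Qed.

Lemma card_constt_le_degree m phi :
  irrQ m phi -> (#|irr_constt (phi : 'CF(G))| <= m)%N.
Proof.
move=> Qphi; rewrite -(ler_nat algC) -(irrQ1 Qphi) {2}(cfun_sum_constt phi) sum_cfunE.
rewrite -sumr_const; apply: ler_sum => i phi_i; rewrite cfunE.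
have /natrP[a Da] : '[phi, 'chi_i] \in Num.nat.
  by rewrite Cnat_cfdot_char_irr // (irrQ_char Qphi).
have /natrP[b Db] : 'chi_i 1%g \in Num.nat by rewrite Cnat_irr1.
rewrite Da Db -natrM ler1n muln_gt0 !lt0n -!(eqr_nat algC) -Da -Db.
by rewrite irr1_neq0 andbT.
Qed.

(** Multiplicities of characters are natural numbers, so nothing can cancel the
contribution of 'chi_i. *)
Lemma cfdot_Res1_constt (H : {group gT}) m (phi : 'CF(G)) i :
    irrQ m phi -> i \in irr_constt phi -> '['Res[H] 'chi_i, 1] != 0 ->
  '['Res[H] phi, 1] != 0.
Proof.
move=> Qphi; have Nphi := irrQ_char Qphi.
case/(constt_charP i Nphi)=> chi' Nchi' -> nz.
rewrite linearD cfdotDl; apply: lt0r_neq0.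
apply: ltr_wpDr; first by rewrite natr_ge0 // Cnat_cfdot_char ?cfRes_char ?cfun1_char.
by rewrite lt_def nz natr_ge0 // Cnat_cfdot_char ?cfRes_char ?irr_char ?cfun1_char.
Qed.

Lemma irrQ_trivial_constt m (phi : 'CF(G)) :
  irrQ m phi -> 0 \in irr_constt phi -> phi = 1 /\ m = 1%N.
Proof.
move=> Qphi; rewrite irr_consttE irr0 => nz.
have Dphi := irrQ_eq Qphi (irrQ_cfun1 G) nz; split=> //.
by apply/eqP; rewrite -(eqr_nat algC) -(irrQ1 Qphi) Dphi cfun11.
Qed.

Lemma irrQ_ortho1 m (phi : 'CF(G)) i :
  irrQ m phi -> i \in irr_constt phi -> i != 0 -> '[phi, 1] = 0.
Proof.
move=> Qphi phi_i nz_i; apply/eqP; apply: contraTT phi_i; rewrite -irr0 => phi0.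
have [-> _] := irrQ_trivial_constt Qphi phi0.
by rewrite irr_consttE -irr0 cfdot_irr [0 == i]eq_sym (negPf nz_i) eqxx.
Qed.

Lemma irrQ_has_constt m (phi : 'CF(G)) :
  irrQ m phi -> (0 < m)%N -> exists i, i \in irr_constt phi.
Proof.
move=> Qphi m_gt0; have [|i phi_i] := @neq0_has_constt _ _ phi; last by exists i.
by rewrite -(char1_eq0 (irrQ_char Qphi)) (irrQ1 Qphi) pnatr_eq0 -lt0n.
Qed.

End RationalConstituents.

(** * Rational characters of a non-abelian group of order p^3 *)

Section RationalCube.

Variables (p : nat) (gT : finGroupType) (G : {group gT}).
Hypotheses (p_prime : prime p) (cardG : #|G| = (p ^ 3)%N).
Hypothesis (nabG : ~~ abelian G).

Let p_gt0 := prime_gt0 p_prime.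
Let p_gt1 := prime_gt1 p_prime.

(** The quotient by the kernel is cyclic, and its exponent divides p because
p-th powers lie in Z(G) = G'. *)
Lemma index_cfker_lin i : 'chi[G]_i \is a linear_char ->
  (#|G : cfker 'chi_i| <= p)%N.
Proof.
move=> Li; have nKG := cfker_norm 'chi_i.
rewrite -card_quotient // -exponent_cyclic; last first.
  suffices defZ: 'Z('chi_i)%CF = G by have := cfcenter_cyclic 'chi_i; rewrite defZ.
  apply/eqP; rewrite eqEsubset cfcenter_sub /=; apply/subsetP=> g Gg.
  by rewrite /cfcenter irr_char inE Gg normC_lin_char // lin_char1 /=.
apply: dvdn_leq => //; apply/exponentP=> _ /morphimP[x nKx Gx ->].
rewrite -morphX //; apply: coset_id; apply: (subsetP (lin_char_der1 Li)).
by rewrite (der1_cube p_prime cardG) // (expg_cube_center p_prime cardG).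
Qed.

(** The kernel of 'chi_i fixes a vector and has index p, so m < p; on the other
hand the p - 1 Galois conjugates of 'chi_i are distinct constituents. *)
Lemma irrQ_lin i m phi :
    'chi[G]_i \is a linear_char -> i != 0 -> irrQ m phi -> i \in irr_constt phi ->
  m = p.-1 /\ #|irr_constt phi| = p.-1.
Proof.
move=> Li nz_i Qphi phi_i; have phi0 := irrQ_ortho1 Qphi phi_i nz_i.
have ltmp: (m < p)%N.
  apply: leq_trans (index_cfker_lin Li).
  apply: (irrQ_degree_bound Qphi (cfker_sub _)) phi0.
  apply: (cfdot_Res1_constt Qphi phi_i).
  suffices ->: 'Res[cfker 'chi_i] 'chi_i = 1 by rewrite cfnorm1 oner_eq0.
  apply/cfun_inP=> x Kx; rewrite cfResE ?cfker_sub // cfun1E Kx cfker1 //.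
  by rewrite lin_char1.
have le_m := card_constt_le_degree Qphi.
suffices le_p: (p.-1 <= #|irr_constt phi|)%N.
  have lemp: (m <= p.-1)%N by rewrite -ltnS prednK.
  by split; apply/eqP; rewrite eqn_leq ?lemp ?le_p ?(leq_trans le_m) ?(leq_trans le_p).
have [g Gg nKg]: exists2 g, g \in G & 'chi_i g != 1.
  apply/exists_inP; apply: contraNT nz_i => /exists_inPn chi1.
  rewrite -irr_eq1; apply/eqP/cfun_inP=> g Gg; rewrite cfun1E Gg.
  by apply/eqP; rewrite -[_ == _]negbK chi1.
have prim: p.-primitive_root ('chi_i g).
  exact: prime_unity_root_prim (lin_char_cubeX p_prime cardG nabG Li Gg) nKg.
have ltk (k : 'I_p.-1): (k.+1 < p)%N by rewrite -ltn_predRL.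
have /fin_all_exists[u Du] (k : 'I_p.-1): exists u : {rmorphism algC -> algC},
  cfAut u 'chi_i g = 'chi_i g ^+ k.+1.
- have co_k: coprime k.+1 p.
    by rewrite coprime_sym prime_coprime // gtnNdvd.
  have [u Du] := Qn_aut_exists co_k; exists u.
  by rewrite cfunE /= Du // prim_expr_order.
have inj_u: injective (fun k => aut_Iirr (u k) i).
  move=> k l /(congr1 (fun j => 'chi_j g)); rewrite !aut_IirrE !Du => /eqP.
  rewrite (eq_prim_root_expr prim) /eqn !modn_small //.
  by rewrite eqSS => /eqP/val_inj.
rewrite -[X in (X <= _)%N]card_ord -(card_codom inj_u); apply: subset_leq_card.
apply/subsetP=> _ /codomP[k ->].
by rewrite irr_consttE (cfdot_irrQ_aut _ _ Qphi).
Qed.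

(* A non-central element of order p is what bounds the multiplicities of the
   non-linear characters: the subgroup <h> has non-zero fixed vectors in their
   representations, and index only p^2. *)
Variable h : gT.
Hypotheses (Gh : h \in G) (nZh : h \notin 'Z(G)%g) (oh : #[h]%g = p).

(** A non-trivial linear constituent would force the degree p - 1, too small for
'chi_i, which has degree p. The p - 1 non-linear characters are conjugate, so
they occur with the same multiplicity c, and the degree c * p * (p - 1) is less than
|G : <h>| = p^2; hence c = 1. *)
Lemma irrQ_nonlin i m phi :
    ~~ ('chi[G]_i \is a linear_char) -> irrQ m phi -> i \in irr_constt phi ->
  m = totient (p ^ 2) /\ phi = \sum_(j | ~~ ('chi[G]_j \is a linear_char)) 'chi_j.
Proof.
move=> nLi Qphi phi_i; have Nphi := irrQ_char Qphi.
have nz_i: i != 0 by apply: contraNneq nLi => ->; rewrite irr0 cfun1_lin_char.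
have phi0 := irrQ_ortho1 Qphi phi_i nz_i.
have phiL j: 'chi_j \is a linear_char -> '[phi, 'chi_j] = 0.
  move=> Lj; apply/eqP; rewrite -[_ == 0]negbK; apply/negP=> phi_j.
  have nz_j: j != 0 by apply: contra phi_j => /eqP->; rewrite irr0 phi0.
  have [Dm _] := irrQ_lin Lj nz_j Qphi phi_j.
  have := char1_ge_constt Nphi phi_i.
  rewrite (nonlinear_degree p_prime cardG) // (irrQ1 Qphi) ler_nat Dm.
  by rewrite leqNgt prednK // leqnn.
have /natrP[c Dc] : '[phi, 'chi_i] \in Num.nat by rewrite Cnat_cfdot_char_irr.
have c_gt0 : (0 < c)%N by rewrite lt0n -(eqr_nat algC) -Dc.
have Dphi: phi = c%:R *: \sum_(j | ~~ ('chi[G]_j \is a linear_char)) 'chi_j.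
  rewrite {1}[phi]cfun_sum_cfdot (bigID (fun j => 'chi_j \is a linear_char)) /=.
  rewrite big1 ?add0r => [|j /phiL->]; last by rewrite scale0r.
  rewrite scaler_sumr; apply: eq_bigr => j nLj; congr (_ *: _).
  have [u Du] := nonlinear_conj p_prime cardG nabG nLi nLj.
  by rewrite Du -aut_IirrE (cfdot_irrQ_aut _ _ Qphi) Dc.
have Dm: m = (c * (p.-1 * p))%N.
  apply/eqP; rewrite -(eqr_nat algC) -(irrQ1 Qphi) Dphi cfunE sum_cfunE natrM.
  rewrite (eq_bigr (fun _ => p%:R)) => [|j nLj]; last exact: nonlinear_degree nLj.
  rewrite sumr_const (eq_card (B := [pred i | ~~ ('chi[G]_i \is a linear_char)])) //.
  by rewrite (card_nonlinear p_prime) // -mulrnA mulnC.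
have ltm: (m < p ^ 2)%N.
  have <-: #|G : <[h]>%g| = (p ^ 2)%N.
    by rewrite -divgS ?cycle_subG // cardG -orderE oh expnSr mulnK.
  apply: (irrQ_degree_bound Qphi _ _ phi0); rewrite ?cycle_subG //.
  apply: (cfdot_Res1_constt Qphi phi_i).
  (* <h> meets the centre trivially, so only the identity contributes. *)
  rewrite cfdotE (bigD1 1%g) //= big1 => [|x /andP[hx nx1]]; last first.
    have [mu [_ _ -> _]] := nonlinear_irrE p_prime cardG nabG nLi.
    rewrite cfResE ?cycle_subG // chi_muE ifN ?mul0r //.
    apply: contra nx1 => Zx; have: x \in (<[h]> :&: 'Z(G))%g by rewrite inE hx.
    by rewrite prime_TIg -?orderE ?oh ?cycle_subG // => /set1P->.
  rewrite addr0 mulf_neq0 ?invr_eq0 ?neq0CG // cfResE ?cycle_subG //.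
  by rewrite (nonlinear_degree p_prime cardG) // cfun11 conjC1 mulr1 pnatr_eq0 -lt0n.
have c1: c = 1%N.
  move: ltm; rewrite Dm mulnA ltn_pmul2r //.
  case: c c_gt0 {Dc Dphi Dm} => // [[|c]] // _.
  rewrite ltnNge; case: (p) p_gt1 => [|[|q]] // _ /negP[].
  apply: (@leq_trans (2 * q.+1)%N); last by rewrite leq_mul2r.
  by rewrite mul2n -addnn addSn ltnS leq_addl.
by rewrite Dm Dphi c1 scale1r mul1n totient_pfactor.
Qed.

Hypothesis p_odd : odd p.
Let p_gt2 : (2 < p)%N. Proof. by rewrite odd_prime_gt2. Qed.

Lemma totient2_gt : (p.-1 < totient (p ^ 2))%N.
Proof. by rewrite totient_pfactor // ltn_Pmulr // -ltnS prednK // ltnW. Qed.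

Lemma pred_p_gt1 : (1 < p.-1)%N. Proof. by rewrite -ltnS prednK. Qed.

Lemma card_irrQ_1 : has_card (@irrQ gT G 1) 1.
Proof.
exists [:: 1]; split=> // phi; rewrite inE; split=> [Qphi | /eqP->]; last exact: irrQ_cfun1.
have [i phi_i] := irrQ_has_constt Qphi isT.
have [i0 | nz_i] := eqVneq i 0.
  by rewrite i0 in phi_i; have [->] := irrQ_trivial_constt Qphi phi_i.
have [Li | nLi] := boolP ('chi_i \is a linear_char).
  by have [Dm _] := irrQ_lin Li nz_i Qphi phi_i; have := pred_p_gt1; rewrite -Dm.
have [Dm _] := irrQ_nonlin nLi Qphi phi_i.
by have := ltn_trans pred_p_gt1 totient2_gt; rewrite -Dm.
Qed.

Lemma ex_nonlinear : exists i, ~~ ('chi[G]_i \is a linear_char).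
Proof.
have /card_gt0P[i nLi]: (0 < #|[pred i | ~~ ('chi[G]_i \is a linear_char)]|)%N.
  by rewrite (card_nonlinear p_prime) // ltnW // pred_p_gt1.
by exists i.
Qed.

Lemma card_irrQ_totient2 : has_card (@irrQ gT G (totient (p ^ 2))) 1.
Proof.
have [i nLi] := ex_nonlinear.
exists [:: \sum_(j | ~~ ('chi[G]_j \is a linear_char)) 'chi_j].
split=> // phi; rewrite inE; split=> [Qphi | /eqP->]; last first.
  have [m [theta [Qtheta theta_i]]] := ex_irrQ_constt i.
  by have [<- <-] := irrQ_nonlin nLi Qtheta theta_i.
have lt1 := ltn_trans pred_p_gt1 totient2_gt.
have [j phi_j] := irrQ_has_constt Qphi (ltnW lt1).
have [Lj | nLj] := boolP ('chi_j \is a linear_char); last first.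
  by have [_ ->] := irrQ_nonlin nLj Qphi phi_j.
have [j0 | nz_j] := eqVneq j 0.
  by rewrite j0 in phi_j; have [_ Dm] := irrQ_trivial_constt Qphi phi_j; rewrite Dm in lt1.
have [Dm _] := irrQ_lin Lj nz_j Qphi phi_j.
by have := totient2_gt; rewrite Dm ltnn.
Qed.

(** The irreducible rational characters of degree p - 1 are the values of theta
on the non-trivial linear characters; each value is taken p - 1 times, because
its fibre is a full block. Counting the p^2 - 1 = (p + 1) * (p - 1) arguments
by their value gives p + 1 values. *)
Lemma card_irrQ_totient : has_card (@irrQ gT G (totient p)) p.+1.
Proof.
rewrite totient_prime //.
have [deg [theta [Qtheta theta_i thetaP]]] := irrQ_family G.
pose D := [pred i | ('chi[G]_i \is a linear_char) && (i != 0)].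
have degD i : (i \in D) = (deg i == p.-1).
  have [-> | nz_i] := eqVneq i 0.
    have [_ ->] := irrQ_trivial_constt (Qtheta 0) (theta_i 0).
    by rewrite inE /= andbF ltn_eqF // pred_p_gt1.
  have [Li | nLi] := boolP ('chi_i \is a linear_char).
    by have [-> _] := irrQ_lin Li nz_i (Qtheta i) (theta_i i); rewrite inE /= Li nz_i eqxx.
  have [-> _] := irrQ_nonlin nLi (Qtheta i) (theta_i i).
  by rewrite inE /= (negPf nLi) gtn_eqF // totient2_gt.
have card_block i : i \in D -> #|[pred j in D | theta j == theta i]| = p.-1.
  move=> /[dup] /andP[Li nz_i] Di.
  have [Ddeg <-] := irrQ_lin Li nz_i (Qtheta i) (theta_i i).
  apply: eq_card => j; rewrite inE /= degD; apply/andP/idP => [[_ /eqP <-] // | theta_j].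
  by have [-> <-] := thetaP _ _ _ (Qtheta i) theta_j; rewrite Ddeg !eqxx.
have cardD: #|D| = (p.+1 * p.-1)%N.
  apply/eqP; rewrite -(eqn_add2l 1); apply/eqP.
  transitivity #|[pred i | 'chi[G]_i \is a linear_char]|.
    rewrite [RHS](cardD1 0) inE /= irr0 cfun1_lin_char; congr (_ + _)%N.
    by apply: eq_card => k; rewrite !inE andbC.
  rewrite card_lin_irr (der1_cube p_prime cardG nabG) (index_center_cube p_prime cardG nabG).
  by case: (p) p_gt0 => // q _; rewrite /= expnS expn1 mulnS [in RHS]mulSn addnA add1n.
pose s : seq 'CF(G) := undup [seq theta i | i <- enum D].
exists s; split; first exact: undup_uniq.
  apply/eqP; rewrite -(eqn_pmul2r (_ : 0 < p.-1)%N) ?(ltnW pred_p_gt1) // -cardD.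
  have Us: uniq s := undup_uniq _.
  rewrite -sum1_card (eq_bigr (fun i => \sum_(y <- s | y == theta i) 1)%N) => [|i Di]; last first.
    rewrite sum1_count count_uniq_mem // mem_undup map_f //.
    by rewrite mem_enum.
  rewrite (exchange_big_dep xpredT) //= big_seq (eq_bigr (fun _ => p.-1)) => [|y s_y].
    by rewrite -big_seq big_const_seq count_predT iter_addn addn0 mulnC.
  have /mapP[i] : y \in [seq theta i | i <- enum D] by rewrite -mem_undup.
  rewrite mem_enum => /card_block <- ->; rewrite sum1_card.
  by apply: eq_card => j; congr andb; apply: eq_sym.
move=> phi; rewrite mem_undup; split=> [Qphi | /mapP[i]]; last first.
  by rewrite mem_enum degD => /eqP <- ->.
have [|i phi_i] := irrQ_has_constt Qphi; first by rewrite ltnW // pred_p_gt1.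
have [-> Ddeg] := thetaP _ _ _ Qphi phi_i.
by apply: map_f; rewrite mem_enum degD -Ddeg.
Qed.

End RationalCube.

(** * The two presentations *)

Section Presentations.

Variable p : nat.
Hypothesis p_prime : prime p.

Lemma mem_join3 (gT : finGroupType) (x y z : gT) (K := (<[x]> <*> <[y]> <*> <[z]>)%G) :
  [/\ x \in K, y \in K & z \in K].
Proof.
by split; rewrite mem_gen // !inE ?cycle_id ?orbT // mem_gen // !inE cycle_id ?orbT.
Qed.

Lemma mem_join2 (gT : finGroupType) (x y : gT) (K := (<[x]> <*> <[y]>)%G) :
  x \in K /\ y \in K.
Proof. by split; rewrite mem_gen // !inE cycle_id ?orbT. Qed.

(** The generators x and y of p^{1+2} serve as x1 and x; then x2 is their
commutator, and its order divides p because [~ x, y] ^+ p = [~ x ^+ p, y] when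
x commutes with [~ x, y]. *)
Lemma Grp_Phi2_111 :
  (p^{1+2} \isog Grp (x : x1 : x2 :
     [~ x1, x] = x2, x ^+ p = 1, x1 ^+ p = 1, x2 ^+ p = 1,
     [~ x2, x] = 1, [~ x2, x1] = 1))%g.
Proof.
move=> rT H; rewrite (Grp_pX1p2 p_prime); apply/existsP/existsP=> /=.
  case=> -[x y] /= /eqP[defH xp yp cx cy]; exists (y, x, [~ x, y]) => /=.
  have cxy: commute x [~ x, y] by apply/esym/commgP/eqP.
  rewrite !xpair_eqE /= xp yp !eqxx /= cx cy -commXg //.
  rewrite xp comm1g !eqxx !andbT -defH eqEsubset !join_subG !cycle_subG.
  have [? ? _] := mem_join3 y x [~ x, y]; have [? ?] := mem_join2 x y.
  by apply/andP; split; apply/andP; split=> //; [apply/andP | rewrite groupR].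
case=> -[[a a1] a2] /= /eqP[defH aa2 ap a1p a2p ca ca1]; exists (a1, a) => /=.
rewrite !xpair_eqE /= aa2 ap a1p ca ca1 !eqxx !andbT -defH.
rewrite eqEsubset !join_subG !cycle_subG -aa2.
have [? ? _] := mem_join3 a a1 [~ a1, a]; have [? ?] := mem_join2 a1 a.
by apply/andP; split; apply/andP; split=> //; [apply/andP | rewrite groupR].
Qed.

(** The modular relation x ^ y = x ^+ p.+1 says that [~ x, y] = x ^+ p, which is
fixed by y since x has order dividing p^2. The relation [~ x1, x] = x ^+ p has
its arguments in the other order, which is why x1 is the inverse of y. *)
Lemma Grp_Phi2_21 :
  ('Mod_(p ^ 3) \isog Grp (x : x1 : x2 :
     [~ x1, x] = x ^+ p, x ^+ p = x2, x1 ^+ p = 1, x2 ^+ p = 1,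
     [~ x2, x] = 1, [~ x2, x1] = 1))%g.
Proof.
move=> rT H; rewrite (Grp_modular_group p_prime) //; apply/existsP/existsP=> /=.
  case=> -[x y] /= /eqP[defH xp yp xy]; exists (x, y^-1, x ^+ p)%g => /=.
  have Rxy: [~ x, y] = (x ^+ p)%g by rewrite commgEl xy expgS mulKg.
  have xpp: ((x ^+ p) ^+ p = 1)%g by rewrite -expgM.
  have cyxp: commute y (x ^+ p)%g.
    apply/commute_sym/commgP/eqP; rewrite commgEl conjXg xy -expgM mulSn expgD.
    by rewrite xp mulg1 mulVg.
  have Rxpy: [~ x ^+ p, y^-1]%g = 1%g by apply/eqP/commgP/commuteV/commute_sym.
  have Ryx: [~ y^-1, x]%g = (x ^+ p)%g.
    by rewrite commVg -invg_comm Rxy ?invgK //; apply/commuteV.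
  have Rxpx : [~ x ^+ p, x]%g = 1%g by apply/eqP/commgP/commute_sym/commuteX.
  rewrite !xpair_eqE /= Ryx Rxpx Rxpy xpp expgVn yp invg1 !eqxx !andbT.
  rewrite -defH eqEsubset !join_subG !cycle_subG.
  have [X3 /groupVr Y3 _] := mem_join3 x y^-1%g (x ^+ p)%g.
  have [X2 Y2] := mem_join2 x y; rewrite invgK in Y3.
  by rewrite !groupX //= !groupV !andbT; apply/and3P; split=> //; apply/andP.
case=> -[[a a1] a2] /= /eqP[defH aa1 ap a1p a2p ca ca1]; exists (a, a1^-1)%g => /=.
rewrite -ap in a2p ca ca1 defH.
have ca1ap: commute a1 (a ^+ p)%g by apply/esym/commgP/eqP.
have aJ: (a ^ a1^-1 = a ^+ p.+1)%g.
  by rewrite conjg_mulR commgV -invg_comm ?invgK aa1 ?expgS //; apply: commuteV.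
have app: (a ^+ (p ^ 2) = 1)%g by rewrite expgM.
rewrite !xpair_eqE /= app aJ expgVn a1p invg1 !eqxx !andbT -defH.
rewrite eqEsubset !join_subG !cycle_subG.
have [A3 B3 _] := mem_join3 a a1 (a ^+ p)%g.
have [A2 /groupVr B2] := mem_join2 a a1^-1%g; rewrite invgK in B2.
by rewrite !groupX //= !groupV !andbT; apply/and3P; split=> //; apply/andP.
Qed.

End Presentations.

Section CubePresentation.

Variables (p : nat) (gT : finGroupType) (G : {group gT}).
Hypotheses (p_prime : prime p) (cardG : #|G| = (p ^ 3)%N).
Hypothesis (nabG : ~~ abelian G).

Let p_gt0 := prime_gt0 p_prime.
Let p_gt1 := prime_gt1 p_prime.

(** An element whose p-th power is not 1 has order p^2, as G is not cyclic, so
it generates a cyclic subgroup of index p. The non-abelian p-groups with such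
a subgroup are classified, and for odd p only the modular group is left. *)
Lemma isog_modular_cube : odd p -> ~~ (exponent G %| p)%N -> G \isog 'Mod_(p ^ 3).
Proof.
move=> p_odd nexp; have pG := pgroup_cube p_prime cardG.
have [x Gx nxp]: exists2 x, x \in G & (x ^+ p)%g != 1%g.
  apply/exists_inP; apply: contraR nexp => /exists_inPn xp1.
  by apply/exponentP=> x /xp1; rewrite negbK => /eqP.
have /(dvdn_pfactor _ _ p_prime)[k le_k3 ox]: (#[x]%g %| p ^ 3)%N.
  by rewrite -cardG order_dvdG.
have ox2: #[x]%g = (p ^ 2)%N.
  case: k le_k3 ox => [|[|[|[|//]]]] _ // ox.
  - by case/eqP: nxp; move/eqP: ox; rewrite order_eq1 => /eqP->; apply: expg1n.
  - by case/eqP: nxp; rewrite expn1 in ox; rewrite -[in LHS]ox expg_order.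
  case/negP: nabG; suffices ->: G :=: <[x]>%g by apply: cycle_abelian.
  by apply/esym/eqP; rewrite eqEcard cycle_subG Gx -orderE ox cardG /=.
have := maximal_cycle_extremal pG nabG (cycle_cyclic x).
have iX: #|G : <[x]>%g| = p.
  by rewrite -divgS ?cycle_subG // cardG -orderE ox2 expnSr mulKn ?expn_gt0 ?p_gt0.
rewrite cycle_subG Gx => /(_ isT iX); case: eqP => [/modular_group_classP | _].
  case=> q q_prime [n n_ge3 isoG] _.
  have eq_pn: (p ^ 3 = q ^ n)%N.
    by rewrite -cardG (card_isog isoG) card_modular_group // (leq_trans _ n_ge3) ?leq_addl.
  have eq_qp: q = p.
    apply/eqP; rewrite -dvdn_prime2 //; have: (q %| p ^ 3)%N.
      by rewrite eq_pn dvdn_exp // (leq_trans _ n_ge3) ?addn_gt0 ?orbT.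
    by rewrite Euclid_dvdX // => /andP[].
  rewrite eq_qp in eq_pn isoG; move/eqP: eq_pn; rewrite eqn_exp2l // => /eqP n3.
  by rewrite n3.
by case/andP=> /eqP p2; rewrite p2 in p_odd.
Qed.

Lemma gen_set3 (x y z : gT) : (<<[set x; y; z]>> = <[x]> <*> <[y]> <*> <[z]>)%g.
Proof.
have [Kx Ky Kz] := mem_join3 x y z.
apply/eqP; rewrite eqEsubset gen_subG !subUset !sub1set Kx Ky Kz.
by rewrite !join_subG !cycle_subG !mem_gen // !inE eqxx ?orbT.
Qed.

Lemma ex_Phi2 : odd p -> exists a a1 a2, Phi2_21 p G a a1 a2 \/ Phi2_111 p G a a1 a2.
Proof.
move=> p_odd; have [expG | nexpG] := boolP (exponent G %| p)%N.
  have isoG := isog_pX1p2 p_prime (extraspecial_cube p_prime cardG nabG) expG cardG.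
  have GrpG := isoGrp_trans isoG (Grp_Phi2_111 p_prime).
  case/existsP: (isoGrp_hom GrpG) => -[[a a1] a2] /= /eqP[defG aa2 ap a1p a2p ca ca1].
  by exists a, a1, a2; right; split=> //; rewrite -defG gen_set3.
have GrpG := isoGrp_trans (isog_modular_cube p_odd nexpG) (Grp_Phi2_21 p_prime).
case/existsP: (isoGrp_hom GrpG) => -[[a a1] a2] /= /eqP[defG aa1 ap a1p a2p ca ca1].
by exists a, a1, a2; left; split=> //; rewrite -defG gen_set3.
Qed.

Variables a a1 a2 : gT.
Hypothesis PhiG : Phi2_21 p G a a1 a2 \/ Phi2_111 p G a a1 a2.

(** The facts on which the two presentations agree suffice for everything that
concerns characters. *)
Lemma Phi2_common :
  [/\ G :=: <<[set a; a1; a2]>>%g, [~ a1, a] = a2, (a1 ^+ p = 1)%g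
    & [~ a2, a] = 1%g /\ [~ a2, a1] = 1%g].
Proof. by case: PhiG => -[_ defG [-> // ? ? ?] ?]. Qed.

Lemma Phi2_mem : [/\ a \in G, a1 \in G & a2 \in G].
Proof.
by have [-> _ _ _] := Phi2_common; split; rewrite mem_gen // !inE eqxx ?orbT.
Qed.

Lemma Phi2_a2_neq1 : a2 != 1%g.
Proof.
have [defG aa2 _ _] := Phi2_common.
apply: contra nabG => /eqP a21; rewrite defG a21 abelian_gen.
have caa1: commute a1 a by apply/commgP; rewrite aa2 a21.
have caa1' := commute_sym caa1.
apply/centsP=> x Ax y Ay; move: Ax Ay; rewrite !inE -!orbA.
by case/or3P=> /eqP-> /or3P[] /eqP->; rewrite ?caa1 //;
  apply: commute1 || apply/commute_sym/commute1.
Qed.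

(** The element a2 is central, because it commutes with the generators, and it
is not 1, so it generates the centre, which has prime order. *)
Lemma Phi2_center : 'Z(G)%g = <[a2]>%g.
Proof.
have [defG aa2 _ [ca ca1]] := Phi2_common; have [Ga Ga1 Ga2] := Phi2_mem.
have oZ := card_center_cube p_prime cardG nabG.
have Za2: a2 \in 'Z(G)%g.
  rewrite inE Ga2 /= defG cent_gen; apply/centP=> x.
  by rewrite !inE -orbA => /or3P[] /eqP-> //; apply/commgP/eqP.
apply/esym/eqP; rewrite eqEcard cycle_subG Za2 /= oZ -orderE.
rewrite (nt_prime_order p_prime) ?Phi2_a2_neq1 //.
by apply/eqP; rewrite -order_dvdn -oZ order_dvdG.
Qed.

Lemma Phi2_a1_notin_center : a1 \notin 'Z(G)%g.
Proof.
have [_ <- _ _] := Phi2_common; have [Ga _ _] := Phi2_mem.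
apply: contra Phi2_a2_neq1 => /setIP[_ /centP/(_ a Ga) caa1].
by have [_ <- _ _] := Phi2_common; apply/commgP.
Qed.

Lemma Phi2_order_a1 : #[a1]%g = p.
Proof.
have [_ _ a1p _] := Phi2_common; apply: nt_prime_order => //.
by apply: contraNneq Phi2_a1_notin_center => ->; apply: group1.
Qed.

End CubePresentation.

(** * Images of number fields *)

Section NumFieldImage.

Variables (L : splittingFieldType rat) (iota : {rmorphism L -> algC}).

(** Closure predicates are boolean, so membership in the image of iota is tested
with a left inverse of iota. *)
Definition num_image : {pred algC} :=
  [pred z | iota (s2val (num_field_proj iota) z) == z].

Lemma num_imageP z : reflect (exists x, iota x = z) (z \in num_image).
Proof.
rewrite inE; apply: (iffP eqP) => [<- | [x <-]]; first by eexists.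
by have iotaK := s2valP' (num_field_proj iota); rewrite iotaK.
Qed.

Fact num_image_divring_closed : divring_closed num_image.
Proof.
split=> [|_ _ /num_imageP[x <-] /num_imageP[y <-]|_ _ /num_imageP[x <-] /num_imageP[y <-]].
- by apply/num_imageP; exists 1; rewrite rmorph1.
- by apply/num_imageP; exists (x - y); rewrite rmorphB.
by apply/num_imageP; exists (x / y); rewrite fmorph_div.
Qed.
HB.instance Definition _ :=
  GRing.isDivringClosed.Build algC num_image num_image_divring_closed.

(** The rationals lie in every subfield F, hence so do the polynomials in iota w
with rational coefficients. *)
Lemma num_image_sub (F : divringClosed algC) w x :
  iota w \in F -> x \in <<1; w>>%VS -> iota x \in F.
Proof.
move=> Fw /Fadjoin_polyP[q /polyOver1P[q' ->] ->].
rewrite horner_coef rmorph_sum rpred_sum // => i _.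
by rewrite coef_map /= mulr_algl rmorphZ_num rmorphXn rpredM ?rpred_rat ?rpredX.
Qed.

End NumFieldImage.

(** * The special required pair *)

Section RequiredPair.

Variables (p : nat) (gT : finGroupType) (G : {group gT}).
Hypotheses (p_prime : prime p) (cardG : #|G| = (p ^ 3)%N).
Hypothesis (nabG : ~~ abelian G).
Variables a a1 a2 : gT.
Hypothesis PhiG : Phi2_21 p G a a1 a2 \/ Phi2_111 p G a a1 a2.

Let p_gt0 := prime_gt0 p_prime.
Let H := <<[set a1; a2]>>%G.
Let defZ := Phi2_center p_prime cardG nabG PhiG.
Let nZa1 := Phi2_a1_notin_center nabG PhiG.
Let oa1 := Phi2_order_a1 p_prime nabG PhiG.

Lemma dprod_H : <[a1]>%g \x 'Z(G)%g = H.
Proof.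
have [Ga Ga1 Ga2] := Phi2_mem PhiG.
have cZa1: 'Z(G)%g \subset 'C(<[a1]>%g).
  by rewrite (subset_trans (subsetIr _ _)) // centS // cycle_subG.
have tiZa1: (<[a1]> :&: 'Z(G) = 1)%g.
  by rewrite prime_TIg -?orderE ?oa1 // cycle_subG.
by rewrite dprodEY //= defZ joing_idl joing_idr.
Qed.

Lemma H_sub : H \subset G.
Proof.
by have [_ Ga1 Ga2] := Phi2_mem PhiG; rewrite gen_subG subUset !sub1set Ga1 Ga2.
Qed.

Lemma card_H : #|H| = (p ^ 2)%N.
Proof.
by rewrite -(dprod_card dprod_H) -orderE oa1 (card_center_cube p_prime cardG nabG).
Qed.

Variable mu : 'CF('Z(G)).
Hypotheses (irr_mu : mu \in irr 'Z(G)) (nKmu : ~~ (G^`(1)%g \subset cfker mu)).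

Let Lmu : mu \is a linear_char.
Proof. by have [] := nonlinear_center_inj p_prime cardG nabG irr_mu nKmu. Qed.
Let inj_mu : {in 'Z(G)%g &, injective mu}.
Proof. by have [] := nonlinear_center_inj p_prime cardG nabG irr_mu nKmu. Qed.

Definition psi_mu : 'CF(H) := cfDprodr dprod_H mu.

Lemma psi_mu_lin : psi_mu \is a linear_char.
Proof. by rewrite cfDprodr_lin_char. Qed.

Lemma psi_muE k z : k \in <[a1]>%g -> z \in 'Z(G)%g -> psi_mu (k * z)%g = mu z.
Proof. exact: cfDprodEr. Qed.

Let Za2 : a2 \in 'Z(G)%g. Proof. by rewrite defZ cycle_id. Qed.

Lemma psi_mu_unique :
  unique (fun xi : 'CF(H) => [/\ xi \is a linear_char, xi a1 = 1 & xi a2 = mu a2]) psi_mu.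
Proof.
split=> [|xi [Lxi xi1 xi2]].
  split; first exact: psi_mu_lin.
    by rewrite -[a1]mulg1 psi_muE ?cycle_id ?group1 ?lin_char1.
  by rewrite -[a2 in LHS]mul1g psi_muE ?group1.
have Ha1: a1 \in H by rewrite mem_gen // !inE eqxx.
have Ha2: a2 \in H by rewrite mem_gen // !inE eqxx orbT.
apply/cfun_inP=> _ /(mem_dprod dprod_H)[k [z [Kk Zz -> _]]]; rewrite psi_muE //.
have /cycleP[i ->] := Kk; have /cycleP[j ->]: z \in <[a2]>%g by rewrite -defZ.
by rewrite lin_charM ?groupX // !lin_charX // xi1 xi2 expr1n mul1r.
Qed.

(** This lemma and the next one show that the values of chi_mu and those of
psi_mu generate the same field, namely the field generated by mu a2. *)
Lemma chi_mu_field (F : divringClosed algC) :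
  {in G, forall g, chi_mu p mu g \in F} <-> mu a2 \in F.
Proof.
split=> [FG | Fmu g Gg].
  have [_ _ Ga2] := Phi2_mem PhiG.
  have := FG _ Ga2; rewrite chi_muE Za2 => Fpmu.
  rewrite -[mu a2](mulKf (_ : p%:R != 0)) ?pnatr_eq0 -?lt0n //.
  by rewrite rpredM ?rpredV ?rpred_nat.
rewrite chi_muE; case: ifP => [Zg | _]; last exact: rpred0.
have /cycleP[j ->]: g \in <[a2]>%g by rewrite -defZ.
by rewrite rpredM ?rpred_nat // lin_charX // rpredX.
Qed.

Lemma psi_mu_field (F : divringClosed algC) :
  {in H, forall h, psi_mu h \in F} <-> mu a2 \in F.
Proof.
split=> [FH | Fmu _ /(mem_dprod dprod_H)[k [z [Kk Zz -> _]]]].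
  rewrite -(psi_muE (group1 _) Za2) mul1g FH //.
  by rewrite mem_gen // !inE eqxx orbT.
rewrite psi_muE //; have /cycleP[j ->]: z \in <[a2]>%g by rewrite -defZ.
by rewrite lin_charX // rpredX.
Qed.

(** On H, chi_mu vanishes off the centre and is p * mu on it, so its inner
product with psi_mu is non-zero; hence chi_mu is a constituent of the induced
character, and the two have the same degree |G : H| = p. *)
Lemma Ind_psi_mu : 'Ind[G] psi_mu = chi_mu p mu.
Proof.
have [i nLi Di] := chi_mu_nonlinear p_prime cardG nabG irr_mu nKmu.
have Lpsi := psi_mu_lin; have Nind := cfInd_char G (lin_charW Lpsi).
have: i \in irr_constt ('Ind[G] psi_mu).
  rewrite irr_consttE -Frobenius_reciprocity -Di cfdotE mulf_neq0 ?invr_eq0 ?neq0CG //.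
  have sZH: 'Z(G) \subset H by rewrite -(dprodW dprod_H) mulG_subr.
  rewrite (bigID (mem 'Z(G)%g)) /= addrC big1 ?add0r; last first.
    by move=> x /andP[Hx nZx]; rewrite cfResE ?H_sub // chi_muE (negPf nZx) conjC0 mulr0.
  rewrite (eq_bigr (fun _ => p%:R)).
    rewrite sumr_const -mulrnA pnatr_eq0 -lt0n muln_gt0 p_gt0 /=.
    by apply/card_gt0P; exists 1%g; rewrite unfold_in /= !group1.
  move=> z /andP[Hz Zz]; rewrite cfResE ?H_sub // chi_muE Zz rmorphM rmorph_nat.
  rewrite -{1}[z]mul1g psi_muE ?group1 // mulrCA -normCK normC_lin_char //.
  by rewrite expr1n mulr1.
case/(constt_charP i Nind)=> chi' Nchi' Dind.
have chi'0: chi' = 0.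
  apply/eqP; rewrite -(char1_eq0 Nchi').
  have := congr1 (fun phi : 'CF(G) => phi 1%g) Dind.
  rewrite cfInd1 ?H_sub // lin_char1 // mulr1 -divgS ?H_sub // cardG card_H.
  rewrite expnS mulnK ?expn_gt0 ?p_gt0 // cfunE.
  rewrite (nonlinear_degree p_prime cardG nabG nLi) => /esym/eqP.
  by rewrite -subr_eq0 addrC addKr.
by rewrite Dind chi'0 addr0 Di.
Qed.

(** The element a1 is the non-central element of order p required to control the
multiplicities. *)
Lemma irrQ_chi_mu :
  exists n (rG : mx_representation rat G n),
    [/\ mx_irreducible rG, '[ratRepr_char rG, chi_mu p mu] = 1
      & ratRepr_char rG = \sum_(j | ~~ ('chi[G]_j \is a linear_char)) 'chi_j].
Proof.
have [i nLi Di] := chi_mu_nonlinear p_prime cardG nabG irr_mu nKmu.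
have [n [_ [[rG [irrG ->]] rG_i]]] := ex_irrQ_constt i.
exists n, rG; have [_ Ga1 _] := Phi2_mem PhiG.
have QrG: irrQ n (ratRepr_char rG) by exists rG.
have [_ DrG] := irrQ_nonlin p_prime cardG nabG Ga1 nZa1 oa1 nLi QrG rG_i.
split=> //; rewrite DrG Di cfdot_suml (bigD1 i) //= cfnorm_irr big1 ?addr0 //.
by move=> j /andP[_ /negPf ne_ji]; rewrite cfdot_irr ne_ji.
Qed.

Lemma schur_index_chi_mu : schur_index (chi_mu p mu) 1.
Proof. by have [n [rG [irrG m1 _]]] := irrQ_chi_mu; exists n, rG. Qed.

Lemma psi_mu_required : special_required_pair (chi_mu p mu) psi_mu.
Proof.
split; [split | exact: H_sub | exact: psi_mu_lin | exact: Ind_psi_mu | move=> z].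
- exact: chi_mu_irr.
- exact: schur_index_chi_mu.
split=> Fz F valF; apply: Fz.
  exact/psi_mu_field/chi_mu_field.
exact/chi_mu_field/psi_mu_field.
Qed.

End RequiredPair.

(** * The character Omega(chi_mu) *)

Section Omega.

Variables (p : nat) (gT : finGroupType) (G : {group gT}).
Hypotheses (p_prime : prime p) (cardG : #|G| = (p ^ 3)%N).
Hypothesis (nabG : ~~ abelian G).
Variables a a1 a2 : gT.
Hypothesis PhiG : Phi2_21 p G a a1 a2 \/ Phi2_111 p G a a1 a2.
Variable mu : 'CF('Z(G)).
Hypotheses (irr_mu : mu \in irr 'Z(G)) (nKmu : ~~ (G^`(1)%g \subset cfker mu)).

Let p_gt0 := prime_gt0 p_prime.
Let p_gt1 := prime_gt1 p_prime.

(** The field Qn generated by a primitive p-th root of unity is a copy of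
Q(chi_mu), as mu a2 is such a root. A Galois automorphism nu of Qn extends to
the algebraic numbers and so sends chi_mu to a non-linear irreducible character
f nu. The map f is injective, because nu is determined by its value at a
generator of Qn, and its image consists of all non-linear characters, because
these are conjugate to chi_mu by automorphisms that restrict to Qn. The sum
over the Galois group is therefore the sum of the non-linear characters. *)
Lemma Omega_chi_mu (theta : 'CF(G)) :
    theta = \sum_(j | ~~ ('chi[G]_j \is a linear_char)) 'chi_j ->
  is_Omega (chi_mu p mu) theta.
Proof.
move=> ->.
have [Lmu inj_mu] := nonlinear_center_inj p_prime cardG nabG irr_mu nKmu.
have defZ := Phi2_center p_prime cardG nabG PhiG.
have oZ := card_center_cube p_prime cardG nabG.
have Za2: a2 \in 'Z(G)%g by rewrite defZ cycle_id.
have oa2: #[a2]%g = p by rewrite orderE -defZ.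
have [i nLi Di] := chi_mu_nonlinear p_prime cardG nabG irr_mu nKmu.
have [Qn galQn [QnC gQnC [w [prim_w defQn] _]]] := group_num_field_exists 'Z(G).
rewrite oZ in prim_w.
have prim_z: p.-primitive_root (mu a2).
  apply: prime_unity_root_prim => //; first by rewrite -oa2 lin_char_unity_root.
  by rewrite -(lin_char1 Lmu) (inj_in_eq inj_mu) ?group1 // -order_gt1 oa2.
have prim_Cw: p.-primitive_root (QnC w) by rewrite fmorph_primitive_root.
have [k Dz] := prim_rootP prim_Cw (prim_expr_order prim_z).
have [l Dw] := prim_rootP prim_z (prim_expr_order prim_Cw).
have Im_chi : {in G, forall g, chi_mu p mu g \in num_image QnC}.
  apply/(chi_mu_field p_prime cardG nabG PhiG irr_mu nKmu).
  by apply/num_imageP; exists (w ^+ k); rewrite rmorphXn.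
have Im_i g : exists x, QnC x = 'chi_i g.
  have [Gg | nGg] := boolP (g \in G); last by exists 0; rewrite rmorph0 cfun0.
  by apply/num_imageP; rewrite -Di Im_chi.
exists 1%N, Qn, QnC; split=> [|z|g x Dx].
- exact: (schur_index_chi_mu p_prime cardG nabG PhiG irr_mu nKmu).
- split=> [Fz | [x <-] F /(chi_mu_field p_prime cardG nabG PhiG irr_mu nKmu) Fmu].
    exact/num_imageP/(Fz (num_image QnC)).
  apply: (num_image_sub (w := w)); last by rewrite defQn memvf.
  by rewrite Dw rpredX.
rewrite mul1r sum_cfunE.
pose f nu := aut_Iirr (sval (gQnC nu)) i.
have fE nu y h : QnC y = 'chi_i h -> 'chi_(f nu) h = QnC (nu y).
  by move=> Dy; rewrite aut_IirrE cfunE /= -Dy; case: (gQnC nu) => u /= ->.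
have inj_f: {in 'Gal({:Qn} / 1)%g &, injective f}.
  (* The full space is generalised to E, on which the type of s depends. *)
  have gal_w (E : {vspace Qn}) : <<1; w>>%VS = E ->
      {in 'Gal(E / 1)%g &, forall s t : gal_of E, s w = t w -> s = t}.
    by case: _ / => s t Gs Gt st_w; apply/eqP; rewrite (gal_adjoin_eq Gs Gt) st_w.
  move=> s t Gs Gt eq_f; apply: (gal_w _ defQn) => //.
  (* w is a power of w ^+ k, which is determined by the value of chi_mu at a2. *)
  have Dw' : w = w ^+ k ^+ l by apply: (fmorph_inj QnC); rewrite !rmorphXn -Dz.
  have Dy: QnC (p%:R * w ^+ k) = 'chi_i a2.
    by rewrite rmorphM rmorph_nat rmorphXn -Dz -Di chi_muE Za2.
  have := congr1 (fun j => 'chi_j a2) eq_f; rewrite !(fE _ _ _ Dy) => /fmorph_inj.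
  rewrite !rmorphM !rmorph_nat => /mulfI eq_wk; rewrite Dw' !(rmorphXn _ l) eq_wk //.
  by rewrite -(fmorph_eq0 QnC) rmorph_nat pnatr_eq0 -lt0n.
have im_f: f @: 'Gal({:Qn} / 1)%g = [set j | ~~ ('chi[G]_j \is a linear_char)].
  apply/setP=> j; rewrite inE; apply/imsetP/idP=> [[nu _ ->] | nLj].
    by rewrite /f aut_IirrE cfAut_lin_char.
  have [u Dj] := nonlinear_conj p_prime cardG nabG nLi nLj.
  have [nuQ DnuQ] := restrict_aut_to_normal_num_field QnC u.
  have hom_nu: kHom 1 {:Qn} (linfun nuQ).
    rewrite k1HomE; apply/ahom_inP.
    by split=> [x1 x2 | ]; rewrite !lfunE ?rmorphM ?rmorph1.
  have [|nu Gnu Dnu] := kHom_to_gal _ (normalFieldf 1) hom_nu.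
    by rewrite !subvf.
  exists nu => //; apply/irr_inj/cfunP=> h; have [y Dy] := Im_i h.
  by rewrite (fE _ _ _ Dy) Dj cfunE /= -Dy -DnuQ -Dnu ?memvf // lfunE.
rewrite (eq_bigl [in f @: 'Gal({:Qn} / 1)%g]) => [|j]; last by rewrite im_f inE.
rewrite big_imset //=; apply: eq_bigr => nu _; rewrite (fE _ x) // Dx.
by rewrite Di.
Qed.

End Omega.

Theorem proposition43 (p : nat) (gT : finGroupType) (G : {group gT})
    (p_prime : prime p) (p_odd : odd p)
    (cardG : #|G| = (p ^ 3)%N) (nabG : ~~ abelian G) :
  [/\ exists a a1 a2 : gT, Phi2_21 p G a a1 a2 \/ Phi2_111 p G a a1 a2,
      [/\ has_card (@irrQ gT G 1) 1,
          has_card (@irrQ gT G (totient p)) p.+1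
        & has_card (@irrQ gT G (totient (p ^ 2))) 1]
    & forall a a1 a2 : gT,
        Phi2_21 p G a a1 a2 \/ Phi2_111 p G a a1 a2 ->
        [/\ 'Z(G)%g = G^`(1)%g,
            G^`(1)%g = <[a2]>%g
          & forall mu : 'CF('Z(G)),
              mu \in irr 'Z(G) -> ~~ (G^`(1)%g \subset cfker mu) ->
              (exists n (rG : mx_representation rat G n),
                 mx_irreducible rG
                 /\ is_Omega (chi_mu p mu) (ratRepr_char rG))
              /\ (exists psi : 'CF(<<[set a1; a2]>>%G),
                    unique (fun xi : 'CF(<<[set a1; a2]>>%G) =>
                              [/\ xi \is a linear_char,
                                  xi a1 = 1 & xi a2 = mu a2]) psi
                    /\ special_required_pair (chi_mu p mu) psi)]].
Proof.
have [a [a1 [a2 PhiG]]] := ex_Phi2 p_prime cardG nabG p_odd.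
have [_ Ga1 _] := Phi2_mem PhiG.
have nZa1 := Phi2_a1_notin_center nabG PhiG.
have oa1 := Phi2_order_a1 p_prime nabG PhiG.
split; first by exists a, a1, a2.
  split.
  - exact: (card_irrQ_1 p_prime cardG nabG Ga1 nZa1 oa1 p_odd).
  - exact: (card_irrQ_totient p_prime cardG nabG Ga1 nZa1 oa1 p_odd).
  exact: (card_irrQ_totient2 p_prime cardG nabG Ga1 nZa1 oa1 p_odd).
move=> {Ga1 nZa1 oa1} b b1 b2 {}PhiG.
have defG' := der1_cube p_prime cardG nabG.
split; [by rewrite defG' | by rewrite defG' (Phi2_center p_prime cardG nabG PhiG) |].
move=> mu irr_mu nKmu.
split.
  have [n [rG [irrG _ DrG]]] := irrQ_chi_mu p_prime cardG nabG PhiG irr_mu nKmu.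
  exists n, rG; split=> //.
  exact: (Omega_chi_mu p_prime cardG nabG PhiG irr_mu nKmu DrG).
exists (psi_mu p_prime cardG nabG PhiG mu); split.
  exact: psi_mu_unique.
exact: psi_mu_required.
Qed.
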